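(* Let $\mathcal{M}$ be a type $\mathrm{III}$ factor. Then there always exists a (unital) von Neumann subalgebra $\mathcal{B}\subseteq\mathcal{M}$ that is regular in $\mathcal{M}$ but not unitarily regular in $\mathcal{M}$.
   Context: For a unital inclusion of von Neumann algebras $\mathcal{B}\subseteq\mathcal{M}$ (i.e. $1_{\mathcal{B}}=1_{\mathcal{M}}$), put $\mathcal{N}_{\mathcal{M}}(\mathcal{B})=\{n\in\mathcal{M}: n\mathcal{B}n^*\cup n^*\mathcal{B}n\subseteq\mathcal{B}\}$ (the normaliser) and $\mathcal{UN}_{\mathcal{M}}(\mathcal{B})=\{u\in\mathcal{M}\text{ unitary}: u\mathcal{B}u^*=\mathcal{B}\}$ (the unitary normaliser). $W^*(S)$ denotes the von Neumann subalgebra of $\mathcal{M}$ generated by $S$. $\mathcal{B}$ is regular in $\mathcal{M}$ if $W^*(\mathcal{N}_{\mathcal{M}}(\mathcal{B}))=\mathcal{M}$ and unitarily regular in $\mathcal{M}$ if $W^*(\mathcal{UN}_{\mathcal{M}}(\mathcal{B}))=\mathcal{M}$. *)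

(* Defs.v *)
From HB Require Import structures.
From mathcomp Require Import all_boot all_order all_algebra.
From mathcomp Require Import sesquilinear complex.
From mathcomp Require Import all_classical all_reals all_analysis.

Set Implicit Arguments.
Unset Strict Implicit.
Unset Printing Implicit Defensive.

Import Order.TTheory GRing.Theory Num.Theory.
Import numFieldNormedType.Exports.

Local Open Scope classical_set_scope.
Local Open Scope ring_scope.

(* Complex Hilbert spaces.  The form is linear in its first argument and
   conjugate-linear in its second. *)
HB.mixin Record CompleteNormedModule_isHilbert (R : realType) H
    & CompleteNormedModule R[i] H := {
  inner : {dot H for Num.conj};
  inner_normE : forall x : H, inner x x = `|x| ^+ 2
}.

#[short(type="hilbertType")]
HB.structure Definition Hilbert (R : realType) :=
  { H of CompleteNormedModule R[i] H & CompleteNormedModule_isHilbert R H }.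

Section Operators.
Variables (R : realType) (H : hilbertType R).
Implicit Types (a b n p q u v x : H -> H) (S M B : set (H -> H)).

(* Operators are represented by their underlying functions. *)
Definition bounded_op : set (H -> H) :=
  [set a | linear a /\ continuous a].

(* By the Riesz representation theorem, a bounded operator has exactly one
   adjoint; outside of the bounded operators the value is irrelevant. *)
Definition adjoint a : H -> H :=
  get [set b | forall x y : H, inner (a x) y = inner x (b y)].

Definition commutant S : set (H -> H) :=
  [set a | bounded_op a /\ forall s, S s -> a \o s = s \o a].

(* A von Neumann algebra on H is a *-subalgebra of the bounded operators on H
   that equals its bicommutant.  It contains the identity of H, so that
   inclusions of von Neumann algebras on the same H are always unital. *)
Record von_neumann_algebra M : Prop := VonNeumannAlgebra {
  vna_bounded : M `<=` bounded_op;
  vna_one : M idfun;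
  vna_add : forall a b, M a -> M b -> M (a + b);
  vna_scale : forall (c : R[i]) a, M a -> M (c *: a);
  vna_mul : forall a b, M a -> M b -> M (a \o b);
  vna_adjoint : forall a, M a -> M (adjoint a);
  vna_bicommutant : commutant (commutant M) = M
}.

Definition vn_subalgebra M B : Prop := von_neumann_algebra B /\ B `<=` M.

(* W^*(S), for S contained in M. *)
Definition vn_generated M S : set (H -> H) :=
  \bigcap_(N in [set N | vn_subalgebra M N /\ S `<=` N]) N.

Definition normaliser M B : set (H -> H) :=
  [set n | M n /\ forall b, B b ->
     B (n \o b \o adjoint n) /\ B (adjoint n \o b \o n)].

Definition unitary u : Prop :=
  adjoint u \o u = idfun /\ u \o adjoint u = idfun.

Definition unitary_normaliser M B : set (H -> H) :=
  [set u | [/\ M u, unitary u & [set u \o b \o adjoint u | b in B] = B]].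

Definition regular_in M B : Prop := vn_generated M (normaliser M B) = M.

Definition unitarily_regular_in M B : Prop :=
  vn_generated M (unitary_normaliser M B) = M.

(* The first condition excludes the algebra {0}, acting on H = {0}. *)
Definition is_factor M : Prop :=
  (idfun : H -> H) <> 0 /\
  M `&` commutant M = [set c *: (idfun : H -> H) | c in [set: R[i]]].

Definition projection_in M : set (H -> H) :=
  [set p | [/\ M p, p \o p = p & adjoint p = p]].

Definition subprojection q p : Prop := p \o q = q.

(* Murray-von Neumann equivalence relative to M. *)
Definition mvn_equiv M p q : Prop :=
  exists v, [/\ M v, adjoint v \o v = p & v \o adjoint v = q].

Definition finite_projection M p : Prop :=
  forall q, projection_in M q -> subprojection q p -> mvn_equiv M p q -> q = p.

Definition typeIII M : Prop :=
  forall p, projection_in M p -> finite_projection M p -> p = 0.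

End Operators.

(* Main.v *)
From HB Require Import structures.
Require Import Defs.
From mathcomp Require Import all_boot all_order all_algebra.
From mathcomp Require Import sesquilinear complex ring.
From mathcomp Require Import all_classical all_reals all_analysis.

Set Implicit Arguments.
Unset Strict Implicit.
Unset Printing Implicit Defensive.

Import Order.TTheory GRing.Theory Num.Theory.
Import numFieldNormedType.Exports.

Local Open Scope classical_set_scope.
Local Open Scope ring_scope.

(** A type III factor [M] contains a system of 3 x 3 matrix units [E i j] with
    [\sum_i E i i = 1], so that [M] is [M_3(A)] with [A] the relative commutant
    of the matrix units.  Take for [B] the copy of the block algebra
    [M_2 + C] inside the copy of [M_3]; it is finite dimensional with minimal
    central projections [e = E 0 0 + E 1 1] and [q = E 2 2].

    [B] is regular.  The compression of [B] by any two minimal projections is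
    one-dimensional, so every [E i j], also when it connects the two blocks,
    satisfies [E i j B E j i <= C (E i i)] and thus normalises [B].  The
    unitaries of [A] commute with [B] and hence normalise it too; they generate
    [A], and [A] together with the [E i j] generates [M].

    [B] is not unitarily regular.  Conjugation by a unitary normaliser is an
    automorphism of [B]; since the blocks [M_2] and [C] are not isomorphic it
    fixes [q].  All unitary normalisers therefore commute with [q], which is
    not central because [M] is a factor.

    The matrix units come from a maximality argument.  Order the systems of
    matrix units in [M] by extension; chains have strong limits, so there is a
    maximal system.  If its remainder [r = 1 - \sum_i E i i] were nonzero, it
    would be infinite, being a projection in a type III algebra: [v^* v = r] and
    [v v^* = q' < r] for some [v] in [M].  The operators [v^i (r - q') v^*^j] would then be matrix
    units below [r], and adding them would contradict maximality
    ([mu_extend], [typeIII_matrix_units]).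

    The analytic tool behind all of this is one minimisation argument
    ([lax_milgram]).  It gives the existence of adjoints, and the bounded
    inverse of [1 + h^2] for self-adjoint [h]; the latter yields the Cayley
    transform of [h], from which [h] can be recovered, so that a von Neumann
    algebra is generated by its unitaries ([vna_generated_by_unitaries]). *)

(** * Inner products and bounded operators *)

(** The order of [R[i]] compares numbers with equal imaginary parts only, so a
    set with a lower bound lies on a horizontal line, on which completeness of
    the reals applies. *)
Lemma complex_inf (R : realType) (S : set R[i]) (b : R[i]) :
  S !=set0 -> (forall s, S s -> b <= s) ->
  exists d, (forall s, S s -> d <= s) /\
            forall e, 0 < e -> exists2 s, S s & s < d + e.
Proof.
move=> [s0 Ss0] lbS.
pose T : set R := [set complex.Re (s - b) | s in S].
have sE s : S s -> s = b + (complex.Re (s - b))%:C%C.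
  move=> Ss; rewrite RRe_real; first by rewrite addrC subrK.
  by rewrite ger0_real// subr_ge0; exact: lbS.
have T0 : has_inf T.
  split; first by exists (complex.Re (s0 - b)), s0.
  exists 0 => _ [s Ss <-]; rewrite -lecR RRe_real.
    by rewrite subr_ge0; exact: lbS.
  by rewrite ger0_real// subr_ge0; exact: lbS.
exists (b + (inf T)%:C%C); split=> [s Ss|e e0].
  rewrite (sE s Ss) lerD2l lecR; apply: ge_inf; first exact: T0.2.
  by exists s.
have eE : e = (complex.Re e)%:C%C by rewrite RRe_real// gtr0_real.
have re0 : 0 < complex.Re e by rewrite -ltcR -eE.
have [_ [s Ss <-] lts] := inf_adherent re0 T0.
exists s => //; rewrite {1}(sE s Ss) -addrA ltrD2l eE -rmorphD ltcR.
exact: lts.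
Qed.

Section InnerProduct.
Variables (R : realType) (H : hilbertType R).
Implicit Types (x y z : H) (c : R[i]).

Lemma innerDl x y z : inner (x + y) z = inner x z + inner y z.
Proof. exact: linearDl. Qed.
Lemma innerDr x y z : inner x (y + z) = inner x y + inner x z.
Proof. exact: linearDr. Qed.
Lemma innerNl x y : inner (- x) y = - inner x y.
Proof. exact: linearNl. Qed.
Lemma innerNr x y : inner x (- y) = - inner x y.
Proof. exact: linearNr. Qed.
Lemma inner0l x : inner 0 x = 0.
Proof. exact: linear0l. Qed.
Lemma inner0r x : inner x 0 = 0.
Proof. exact: linear0r. Qed.
Lemma innerZl c x y : inner (c *: x) y = c * inner x y.
Proof. by rewrite linearZl_LR. Qed.
Lemma innerZr c x y : inner x (c *: y) = c^* * inner x y.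
Proof. by rewrite linearZr_LR. Qed.
Lemma innerC x y : inner x y = (inner y x)^*.
Proof. by rewrite hermC expr0 mul1r. Qed.

Definition innerE := (innerDl, innerDr, innerNl, innerNr, innerZl, innerZr).

Lemma inner_ge0 x : 0 <= inner x x.
Proof. by rewrite inner_normE exprn_ge0. Qed.

Lemma inner_eq0 x : inner x x = 0 -> x = 0.
Proof. by rewrite inner_normE => /eqP; rewrite sqrf_eq0 normr_eq0 => /eqP. Qed.

Lemma inner_injl x y : (forall z, inner x z = inner y z) -> x = y.
Proof.
move=> xy; apply/eqP; rewrite -subr_eq0; apply/eqP/inner_eq0.
by rewrite innerDl innerNl xy subrr.
Qed.

Lemma inner_injr x y : (forall z, inner z x = inner z y) -> x = y.
Proof. by move=> xy; apply: inner_injl => z; rewrite innerC xy -innerC. Qed.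

(** The component of [x] orthogonal to [y] has nonnegative square norm. *)
Lemma cauchy_schwarz x y : `|inner x y| <= `|x| * `|y|.
Proof.
rewrite -(@ler_pXn2r _ 2)// ?nnegrE ?mulr_ge0// exprMn -!inner_normE.
have [->|y0] := eqVneq y 0; first by rewrite !inner0r normr0 expr0n mulr0.
have yy0 : 0 < inner y y by rewrite inner_normE exprn_gt0// normr_gt0.
set a := inner x y / inner y y.
have := inner_ge0 (x - a *: y); rewrite !innerE -/a.
have yyr : (inner y y)^* = inner y y by rewrite -innerC.
have -> : inner y x = (inner x y)^* by rewrite -innerC.
have -> : a^* = (inner x y)^* / inner y y by rewrite /a rmorphM fmorphV /= yyr.
rewrite normCK -subr_ge0 => h.
suff -> : inner x x * inner y y - inner x y * (inner x y)^* =
  inner y y * (inner x x - (inner x y)^* / inner y y * inner x y +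
     (- (a * (inner x y)^*) -  - (a * ((inner x y)^* / inner y y * inner y y)))).
  apply: mulr_ge0; first exact: ltW.
  move: h; congr (0 <= _); rewrite /a; field; exact: lt0r_neq0.
by rewrite /a; field; exact: lt0r_neq0.
Qed.

End InnerProduct.

Section Bounded.
Variables (R : realType) (H : hilbertType R).
Implicit Types (x y z : H) (c : R[i]) (a b : H -> H).

Lemma bopP a (ba : bounded_op a) c x y : a (c *: x + y) = c *: a x + a y.
Proof. by case: ba => la _; exact: la. Qed.
Lemma bopD a (ba : bounded_op a) x y : a (x + y) = a x + a y.
Proof. by rewrite -[x]scale1r (bopP ba) !scale1r. Qed.
Lemma bop0 a (ba : bounded_op a) : a 0 = 0.
Proof. by apply: (@addrI _ (a 0)); rewrite -(bopD ba) !addr0. Qed.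
Lemma bopZ a (ba : bounded_op a) c x : a (c *: x) = c *: a x.
Proof. by rewrite -[c *: x]addr0 (bopP ba) (bop0 ba) addr0. Qed.
Lemma bopN a (ba : bounded_op a) x : a (- x) = - a x.
Proof. by rewrite -scaleN1r (bopZ ba) scaleN1r. Qed.
Lemma bopB a (ba : bounded_op a) x y : a (x - y) = a x - a y.
Proof. by rewrite (bopD ba) (bopN ba). Qed.
Lemma bop_sum a (ba : bounded_op a) (I : finType) (F : I -> H) :
  a (\sum_i F i) = \sum_i a (F i).
Proof.
elim/big_rec2: _ => [|i y z _ <-]; first exact: bop0.
exact: bopD.
Qed.

Lemma bounded_opP a : linear a ->
  bounded_op a <-> exists2 K, 0 < K & forall x, `|a x| <= K * `|x|.
Proof.
move=> la; pose A := GRing.isLinear.Build _ _ _ _ a la.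
pose f : {linear H -> H} := HB.pack a A.
split=> [[_ ca]|[K K0 aK]].
- have /linear_boundedP := @continuous_linear_bounded _ _ _ 0 f (ca 0).
  move=> [M [Mr]] h; exists (`|M| + 1); first by rewrite ltr_wpDl.
  apply: h; rewrite (le_lt_trans (real_ler_norm Mr))// ltrDl//.
- split=> //; apply: (@bounded_linear_continuous _ _ _ f).
  apply/linear_boundedP; exists K; split; first exact: gtr0_real.
  by move=> r Kr x; rewrite (le_trans (aK x))// ler_wpM2r// ltW.
Qed.

Lemma bop_bound a : bounded_op a ->
  exists2 K, 0 < K & forall x, `|a x| <= K * `|x|.
Proof. by move=> ba; apply/(bounded_opP ba.1). Qed.

Lemma bounded_op_id : bounded_op (idfun : H -> H).
Proof. by split=> // x. Qed.

Lemma bounded_op_comp a b : bounded_op a -> bounded_op b -> bounded_op (a \o b).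
Proof.
move=> ba bb; split; first by move=> c x y /=; rewrite (bopP bb) (bopP ba).
by move=> x; apply: continuous_comp; [exact: bb.2|exact: ba.2].
Qed.

Lemma bounded_op_add a b : bounded_op a -> bounded_op b -> bounded_op (a + b).
Proof.
move=> ba bb; split.
  move=> c x y; change (a (c *: x + y) + b (c *: x + y) =
    c *: (a x + b x) + (a y + b y)).
  by rewrite (bopP ba) (bopP bb) scalerDr addrACA.
by move=> x; apply: cvgD; [exact: ba.2|exact: bb.2].
Qed.

Lemma bounded_op_scale c a : bounded_op a -> bounded_op (c *: a).
Proof.
move=> ba; split.
  move=> d x y; change (c *: a (d *: x + y) = d *: (c *: a x) + c *: a y).
  by rewrite (bopP ba) scalerDr !scalerA mulrC.
by move=> x; apply: cvgZl_tmp; exact: ba.2.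
Qed.

End Bounded.

(** * Limits and minimisation *)
Section Limits.
Variables (R : realType) (H : hilbertType R).
Variables (T : Type) (F : set_system T).
Context {PF : ProperFilter F}.

Lemma cauchy_limit (f : T -> H) :
  (forall e, 0 < e -> exists y, F [set t | `|y - f t| < e]) ->
  exists l : H, f t @[t --> F] --> l.
Proof.
move=> fC; apply/cvg_ex/cauchy_cvgP/cauchyP => e e0.
have [y Fy] := fC e e0; exists y; move: Fy; rewrite -ball_normE.
exact.
Qed.

Lemma cvg_innerr (f : T -> H) (l z : H) :
  f t @[t --> F] --> l -> inner z (f t) @[t --> F] --> inner z l.
Proof.
move=> /cvgrPdist_lt fl; apply/cvgrPdist_lt => e e0.
have z0 : 0 < `|z| + 1 by rewrite ltr_wpDl.
near=> t; rewrite -linearBr (le_lt_trans (cauchy_schwarz _ _))//.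
rewrite (@le_lt_trans _ _ ((`|z| + 1) * `|l - f t|))//.
  by rewrite ler_wpM2r// lerDl.
rewrite mulrC -ltr_pdivlMr//; near: t; apply: fl; exact: divr_gt0.
Unshelve. all: by end_near. Qed.

Lemma cvg_innerl (f : T -> H) (l z : H) :
  f t @[t --> F] --> l -> inner (f t) z @[t --> F] --> inner l z.
Proof.
move=> /cvgrPdist_lt fl; apply/cvgrPdist_lt => e e0.
have z0 : 0 < `|z| + 1 by rewrite ltr_wpDl.
near=> t; rewrite -innerNl -innerDl (le_lt_trans (cauchy_schwarz _ _))//.
rewrite (@le_lt_trans _ _ ((`|z| + 1) * `|l - f t|))//.
  by rewrite mulrC ler_wpM2r// lerDl.
rewrite mulrC -ltr_pdivlMr//; near: t; apply: fl; exact: divr_gt0.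
Unshelve. all: by end_near. Qed.

Lemma cvg_bop (a : H -> H) (f : T -> H) (l : H) : bounded_op a ->
  f t @[t --> F] --> l -> a (f t) @[t --> F] --> a l.
Proof. by move=> ba fl; apply: continuous_cvg => //; exact: ba.2. Qed.

End Limits.

Section LaxMilgram.
Variables (R : realType) (H : hilbertType R).

Lemma add_conj_le (z : R[i]) : z + z^* <= 2 * `|z|.
Proof.
have -> : z + z^* = 2 * 'Re z by rewrite ReE; field.
by rewrite ler_pM2l//; exact: (leif_Re_Creal z).1.
Qed.

(** The functional [J x = q x x - 2 Re (f x)], with
    [q x y = inner x y + inner (T x) (T y)], is bounded below.  By the
    parallelogram identity its near-minimisers form a Cauchy filter, and at the
    limit the first variation of [J], which is [q x y - f x], vanishes.  With
    [T = 0] this is the Riesz representation theorem; with [T] self-adjoint it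
    solves [y + T (T y) = z]. *)
Lemma lax_milgram (T : H -> H) (f : H -> R[i]) (K : R[i]) :
  bounded_op T -> 0 <= K -> (forall c x y, f (c *: x + y) = c * f x + f y) ->
  (forall x, `|f x| <= K * `|x|) ->
  exists y, forall x, f x = inner x y + inner (T x) (T y).
Proof.
move=> bT K0 fP fK.
have f0 : f 0 = 0.
  by have := fP (-1) 0 0; rewrite scaler0 addr0 mulN1r addNr.
have fD x y : f (x + y) = f x + f y.
  by rewrite -[x]scale1r fP mul1r scale1r.
have fZ c x : f (c *: x) = c * f x.
  by rewrite -[c *: x]addr0 fP f0 addr0.
pose q x y := inner x y + inner (T x) (T y).
have qDl x y z : q (x + y) z = q x z + q y z.
  by rewrite /q (bopD bT) !innerDl; ring.
have qZl c x y : q (c *: x) y = c * q x y.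
  by rewrite /q (bopZ bT) !innerZl; ring.
have qC x y : q x y = (q y x)^*.
  by rewrite /q rmorphD /= -!innerC.
have qDr x y z : q z (x + y) = q z x + q z y.
  by rewrite qC qDl rmorphD /= -!qC.
have q_norm x : `|x| ^+ 2 <= q x x.
  by rewrite /q -inner_normE lerDl inner_ge0.
have q_cvg (F : set_system H) (y z : H) : ProperFilter F ->
    x @[x --> F] --> y -> q z x @[x --> F] --> q z y.
  by move=> PF Fy; apply: cvgD; apply: cvg_innerr => //; exact: cvg_bop.
suff [y yP] : exists y, forall x, f x = q x y by exists y.
(* Only the sesquilinear behaviour of [q] matters from here on. *)
clearbody q.
pose J x := q x x - (f x + (f x)^*).
have JD x w : J (x + w) = J x + q w w + ((q w x - f w) + (q w x - f w)^*).
  rewrite /J qDl !qDr fD !rmorphD /= (qC x w) rmorphN /=; ring.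
have Jlb x : - K ^+ 2 <= J x.
  have h := le_trans (add_conj_le (f x)) (ler_wpM2l (ler0n _ 2) (fK x)).
  rewrite -subr_ge0 opprK (@le_trans _ _ ((`|x| - K) ^+ 2))//.
    by rewrite real_exprn_even_ge0// realB ?normr_real ?ger0_real.
  have -> : (`|x| - K) ^+ 2 = `|x| ^+ 2 - 2 * (K * `|x|) + K ^+ 2 by ring.
  by rewrite lerD2r lerB.
clearbody J.
have [||d [dJ Jd]] := @complex_inf R [set J x | x in setT] (- K ^+ 2).
- by exists (J 0), 0.
- by move=> _ [x _ <-]; exact: Jlb.
have {}dJ x : d <= J x by apply: dJ; exists x.
have {}Jd e : 0 < e -> exists x, J x < d + e.
  by move=> /Jd[_ [x _ <-]]; exists x.
(* The filter generated by the near-minimisers of [J]. *)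
pose F : set_system H := [set P | exists2 e, 0 < e & forall x, J x < d + e -> P x].
have PF : ProperFilter F.
  apply: Build_ProperFilter_ex => [P [e e0 eP]|].
    by have [x Jx] := Jd e e0; exists x; exact: eP.
  split; first by exists 1.
  - move=> P Q [e e0 eP] [e' e'0 eQ].
    have r : e >=< e' by rewrite real_comparable// gtr0_real.
    exists (Order.min e e').
      by rewrite comparable_lt_min ?e0 ?e'0.
    move=> x; rewrite -ltrBlDl comparable_lt_min// !ltrBlDl => /andP[].
    by move=> /eP ? /eQ.
  - by move=> P Q PQ [e e0 eP]; exists e => // x /eP /PQ.
have JF e : 0 < e -> F [set x | J x < d + e] by move=> e0; exists e.
have close x y e : 0 < e -> J x < d + e -> J y < d + e -> `|x - y| ^+ 2 < 4 * e.
  move=> e0 Jx Jy.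
  pose m := 2^-1 *: (x + y); pose w := 2^-1 *: (x - y).
  have halfK z : 2^-1 *: (z + z) = z :> H.
    by rewrite scalerDr -scalerDl (_ : _ + _ = 1) ?scale1r//; field.
  have xE : x = m + w.
    by rewrite /m /w -scalerDr addrACA subrr addr0 halfK.
  have yE : y = m + (-1) *: w.
    by rewrite scaleN1r /m /w -scalerBr opprB [x + y]addrC addrACA subrr addr0 halfK.
  have : J x + J y < (d + e) + (d + e) by rewrite ltrD.
  rewrite xE yE !JD.
  set g := q w m - f w.
  have -> : q (-1 *: w) (-1 *: w) = q w w.
    by rewrite qZl qC qZl rmorphM /= -qC rmorphN rmorph1; ring.
  have -> : q (-1 *: w) m - f (-1 *: w) = - g by rewrite qZl fZ /g; ring.
  have -> : J m + q w w + (g + g^*) + (J m + q w w + (- g + (- g)^*)) =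
    2 * (J m + q w w) by rewrite rmorphN /=; ring.
  have -> : d + e + (d + e) = 2 * (d + e) by ring.
  rewrite ltr_pM2l// => h.
  have {}h : q w w < e.
    rewrite -(ltrD2l d); apply: le_lt_trans h; rewrite lerD2r; exact: dJ.
  have := le_lt_trans (q_norm w) h.
  rewrite /w normrZ exprMn normrV ?unitfE ?pnatr_eq0// ger0_norm//.
  have -> : m + w - (m + -1 *: w) = x - y by rewrite -xE -yE.
  move=> h2; rewrite -ltr_pdivrMl//.
  suff -> : 4^-1 = (2^-1 : R[i]) ^+ 2 by [].
  by field.
(* Moving from a near-minimiser [x] along [z] cannot decrease [J] by [e] or
   more.  The step below would be optimal if [q z z] were [q z z + 1]; the
   enlargement avoids a division by zero. *)
have var x z e : 0 < e -> J x < d + e ->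
    `|q z x - f z| ^+ 2 < e * (q z z + 1).
  move=> e0 Jx; set g := q z x - f z; pose Q := q z z + 1.
  have Q0 : 0 < Q by rewrite ltr_wpDl// (le_trans _ (q_norm z))// exprn_ge0.
  have Qr : Q^* = Q by rewrite conj_Creal// gtr0_real.
  have := dJ (x + (- (Q^-1 * g^*)) *: z); rewrite JD.
  have -> : q (- (Q^-1 * g^*) *: z) (- (Q^-1 * g^*) *: z) =
      (g * g^*) / Q ^+ 2 * (Q - 1).
    rewrite qZl qC qZl rmorphM /= -qC rmorphN rmorphM /= fmorphV /= Qr conjCK.
    by rewrite /Q; field; exact: lt0r_neq0.
  have -> : q (- (Q^-1 * g^*) *: z) x - f (- (Q^-1 * g^*) *: z) = - (g * g^*) / Q.
    by rewrite qZl fZ /g; field; exact: lt0r_neq0.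
  have -> : (- (g * g^*) / Q)^* = - (g * g^*) / Q.
    by rewrite rmorphM rmorphN rmorphM /= fmorphV /= Qr conjCK [g^* * g]mulrC.
  have -> : J x + (g * g^*) / Q ^+ 2 * (Q - 1) +
     (- (g * g^*) / Q + - (g * g^*) / Q) =
     J x - (g * g^*) / Q - (g * g^*) / Q ^+ 2 by field; exact: lt0r_neq0.
  rewrite -normCK -/Q => h.
  rewrite -ltr_pdivrMr//.
  rewrite -(ltrD2l d) (le_lt_trans _ Jx)// -lerBrDr (le_trans h)//.
  by rewrite gerBl divr_ge0// exprn_ge0// ltW.
have [y Fy] : exists y : H, (fun x => x) t @[t --> F] --> y.
  apply: cauchy_limit => e e0.
  have e4 : 0 < e ^+ 2 / 4 by rewrite divr_gt0// exprn_gt0.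
  have [y Jy] := Jd _ e4; exists y.
  apply: filterS (JF _ e4) => x Jx.
  have := close _ _ _ e4 Jy Jx; rewrite mulrC divfK ?pnatr_eq0//.
  by rewrite ltr_pXn2r// nnegrE// ltW.
exists y => z; apply/esym.
have c1 : q z x @[x --> F] --> q z y.
  exact: q_cvg.
have c2 : q z x @[x --> F] --> (f z : (R[i] : numFieldType)).
  apply/cvgrPdist_lt => e e0.
  have Q0 : 0 < q z z + 1.
    by rewrite ltr_wpDl// (le_trans _ (q_norm z))// exprn_ge0.
  have e4 : 0 < e ^+ 2 / (q z z + 1) by rewrite divr_gt0// exprn_gt0.
  apply: filterS (JF _ e4) => x Jx; rewrite distrC.
  have := var _ z _ e4 Jx; rewrite divfK ?lt0r_neq0//.
  by rewrite ltr_pXn2r// nnegrE// ltW.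
exact: (cvg_unique _ c1 c2).
Qed.

End LaxMilgram.

(** * Adjoints *)
Section Adjoint.
Variables (R : realType) (H : hilbertType R).
Implicit Types (x y z : H) (c : R[i]) (a b : H -> H).

Lemma adjoint_eq a b :
  (forall x y, inner (a x) y = inner x (b y)) -> adjoint a = b.
Proof.
move=> ab; rewrite /adjoint; set P := [set _ | _].
have Pg : P (get P) by apply: getPex; exists b.
by apply/funext => y; apply: inner_injr => x; rewrite -Pg ab.
Qed.

Lemma bounded_op0 : bounded_op (fun=> 0 : H).
Proof.
split; first by move=> c x y; rewrite scaler0 addr0.
by move=> x; exact: cvg_cst.
Qed.

(** The Riesz representation of [x |-> inner (a x) y] provides the value of the
    adjoint at [y], so the choice made in [adjoint] is a genuine adjoint. *)
Lemma inner_adjoint a x y : bounded_op a -> inner (a x) y = inner x (adjoint a y).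
Proof.
move=> ba; have [K K0 aK] := bop_bound ba.
have /choice[b ab] : forall y, exists z, forall x, inner (a x) y = inner x z.
  move=> {}y; have [|c u v|u|z zP] :=
    @lax_milgram R H (fun=> 0) (fun x => inner (a x) y) (K * `|y|) bounded_op0.
  - by rewrite mulr_ge0// ltW.
  - by rewrite (bopP ba) innerDl innerZl.
  - rewrite (le_trans (cauchy_schwarz _ _))// mulrAC ler_wpM2r//.
  - by exists z => u; rewrite zP inner0l addr0.
by rewrite (@adjoint_eq a b)// => u v; exact: ab.
Qed.

Lemma inner_adjointr a x y : bounded_op a -> inner x (a y) = inner (adjoint a x) y.
Proof. by move=> ba; rewrite innerC inner_adjoint// -innerC. Qed.

Lemma adjointK a : bounded_op a -> adjoint (adjoint a) = a.
Proof. by move=> ba; apply: adjoint_eq => x y; rewrite -inner_adjointr. Qed.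

Lemma bounded_adjoint a : bounded_op a -> bounded_op (adjoint a).
Proof.
move=> ba; have [K K0 aK] := bop_bound ba.
apply/bounded_opP.
  move=> c x y; apply: inner_injl => z.
  by rewrite !(innerDl, innerZl) -!inner_adjointr// innerDl innerZl.
exists K => // x.
have [->|ax0] := eqVneq (adjoint a x) 0.
  by rewrite normr0 mulr_ge0// ltW.
rewrite -(@ler_pM2r _ `|adjoint a x|) ?normr_gt0// -expr2 -inner_normE.
rewrite -[X in X <= _]ger0_norm ?inner_ge0// -inner_adjointr//.
by rewrite (le_trans (cauchy_schwarz _ _))// [K * _]mulrC -mulrA ler_wpM2l// aK.
Qed.

Lemma adjoint_add a b : bounded_op a -> bounded_op b ->
  adjoint (a + b) = adjoint a + adjoint b.
Proof.
move=> ba bb; apply: adjoint_eq => x y.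
change (inner (a x + b x) y = inner x (adjoint a y + adjoint b y)).
by rewrite innerDl innerDr !inner_adjoint.
Qed.

Lemma adjoint_scale c a : bounded_op a -> adjoint (c *: a) = c^* *: adjoint a.
Proof.
move=> ba; apply: adjoint_eq => x y.
change (inner (c *: a x) y = inner x (c^* *: adjoint a y)).
by rewrite innerZl innerZr conjCK inner_adjoint.
Qed.

End Adjoint.

(** * Commutants and von Neumann algebras *)
Section VonNeumann.
Variables (R : realType) (H : hilbertType R).
Implicit Types (x y z : H) (c : R[i]) (a b : H -> H) (S M N : set (H -> H)).

Lemma comm_app a b : a \o b = b \o a -> forall x, a (b x) = b (a x).
Proof. by move=> ab x; rewrite -[LHS]/((a \o b) x) ab. Qed.

Lemma commutantP S a : commutant S a <->
  bounded_op a /\ forall s, S s -> forall x, a (s x) = s (a x).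
Proof.
split=> -[ba h]; split=> // s Ss; first exact: (comm_app (h s Ss)).
by apply/funext => x; exact: h.
Qed.

Lemma commutant_app S a s : commutant S a -> S s -> forall x, a (s x) = s (a x).
Proof. by move=> /commutantP[_ h] Ss; exact: h. Qed.

Lemma commutant_anti S S' : S `<=` S' -> commutant S' `<=` commutant S.
Proof. by move=> SS' a [ba h]; split=> // s /SS' /h. Qed.

Lemma sub_bicommutant S : S `<=` @bounded_op R H -> S `<=` commutant (commutant S).
Proof. by move=> bS s Ss; split=> [|a [_ h]]; [exact: bS|rewrite h]. Qed.

Lemma commutant_vna S : S `<=` @bounded_op R H ->
  (forall s, S s -> S (adjoint s)) -> von_neumann_algebra (commutant S).
Proof.
move=> bS aS; split.
- by move=> a [].
- by split=> //; exact: bounded_op_id.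
- move=> a b /commutantP[ba ha] /commutantP[bb hb]; apply/commutantP.
  split=> [|s Ss x]; first exact: bounded_op_add.
  change (a (s x) + b (s x) = s (a x + b x)).
  by rewrite ha// hb// (bopD (bS _ Ss)).
- move=> c a /commutantP[ba ha]; apply/commutantP.
  split=> [|s Ss x]; first exact: bounded_op_scale.
  change (c *: a (s x) = s (c *: a x)).
  by rewrite ha// (bopZ (bS _ Ss)).
- move=> a b /commutantP[ba ha] /commutantP[bb hb]; apply/commutantP.
  by split=> [|s Ss x /=]; [exact: bounded_op_comp|rewrite hb// ha].
- move=> a /commutantP[ba ha]; apply/commutantP.
  split=> [|s Ss x]; first exact: bounded_adjoint.
  have bs := bS _ Ss; apply: inner_injl => y.
  rewrite -inner_adjointr// inner_adjoint// -ha; last exact: aS.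
  by rewrite inner_adjointr// -inner_adjoint.
- apply/seteqP; split; last by apply: sub_bicommutant => a [].
  exact/commutant_anti/sub_bicommutant.
Qed.

Lemma vna_bop M a : von_neumann_algebra M -> M a -> bounded_op a.
Proof. by move=> vM; exact: (vna_bounded vM). Qed.

Lemma mem_vna M a : von_neumann_algebra M ->
  (bounded_op a /\ forall b, commutant M b -> forall x, a (b x) = b (a x)) -> M a.
Proof. by move=> vM /commutantP; rewrite vna_bicommutant. Qed.

Lemma vna_opp M a : von_neumann_algebra M -> M a -> M (- a).
Proof. by move=> vM Ma; rewrite -scaleN1r; exact: vna_scale. Qed.

Lemma vna_diff M a b : von_neumann_algebra M -> M a -> M b -> M (a - b).
Proof. by move=> vM Ma Mb; apply: vna_add => //; exact: vna_opp. Qed.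

Lemma vna_zero M : von_neumann_algebra M -> M 0.
Proof.
by move=> vM; rewrite -(scale0r (idfun : H -> H)); exact: (vna_scale vM 0 (vna_one vM)).
Qed.

Lemma vna_sum M (I : finType) (F : I -> H -> H) : von_neumann_algebra M ->
  (forall i, M (F i)) -> M (\sum_i F i).
Proof.
move=> vM MF; elim/big_ind: _ => //; [exact: vna_zero|exact: vna_add].
Qed.

Lemma sum_opE (I : finType) (F : I -> H -> H) x : (\sum_i F i) x = \sum_i F i x.
Proof. by elim/big_rec2: _ => // i y1 y2 _ <-. Qed.

Lemma vna_commutant M : von_neumann_algebra M ->
  von_neumann_algebra (commutant M).
Proof. by move=> vM; apply: commutant_vna => [a /(vna_bop vM)//|]; exact: vna_adjoint. Qed.

(** A relative commutant is a full commutant, because [M] is the commutant of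
    its commutant; this is how relative commutants inherit the structure of a
    von Neumann algebra. *)
Lemma rel_commutantE M S : von_neumann_algebra M -> S `<=` @bounded_op R H ->
  commutant (commutant M `|` S) = M `&` commutant S.
Proof.
move=> vM bS; apply/seteqP; split=> [a /commutantP[ba h]|a [Ma /commutantP[ba h]]].
  split; last by apply/commutantP; split=> // s Ss; apply: h; right.
  by apply: mem_vna => //; split=> // b Mb; apply: h; left.
apply/commutantP; split=> // s [Ms|Ss]; last exact: h.
by move=> x; rewrite (commutant_app Ms Ma).
Qed.

Lemma rel_commutant_vna M S : von_neumann_algebra M -> S `<=` @bounded_op R H ->
  (forall s, S s -> S (adjoint s)) -> von_neumann_algebra (M `&` commutant S).
Proof.
move=> vM bS aS; rewrite -rel_commutantE//; apply: commutant_vna.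
  by move=> a [[]|/bS].
move=> a [Ma|/aS ?]; [left|by right].
exact: (vna_adjoint (vna_commutant vM)).
Qed.

(** [r] is the inverse of [1 + h^2].  It commutes with everything that
    commutes with [h], which puts it in [N]. *)
Lemma resolvent_exists N h : von_neumann_algebra N -> N h -> adjoint h = h ->
  exists r, [/\ N r, adjoint r = r, (forall x, r x + h (h (r x)) = x) &
    (forall x, h (r x) = r (h x))].
Proof.
move=> vN Nh ah; have bh := vna_bop vN Nh.
have /choice[r rP] : forall z, exists y, y + h (h y) = z.
  move=> z; have [|c u v|u|y yP] :=
    @lax_milgram R H h (fun x => inner x z) `|z| bh.
  - by [].
  - by rewrite innerDl innerZl.
  - by rewrite mulrC cauchy_schwarz.
  - exists y; apply: inner_injr => x; rewrite yP innerDr; congr (_ + _).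
    by rewrite inner_adjointr// ah.
have inj y y' : y + h (h y) = y' + h (h y') -> y = y'.
  move=> e; apply/eqP; rewrite -subr_eq0; apply/eqP; set w := y - y'.
  have w0 : w + h (h w) = 0.
    rewrite /w !(bopB bh) addrACA -opprD e; exact: subrr.
  have : inner (w + h (h w)) w = 0 by rewrite w0 inner0l.
  rewrite innerDl inner_adjoint// ah => /eqP.
  by rewrite paddr_eq0 ?inner_ge0// => /andP[/eqP/inner_eq0].
have lr : linear r.
  move=> c x y; apply: inj.
  by rewrite rP !(bopP bh) addrACA -scalerDr !rP.
have br : bounded_op r.
  apply/(bounded_opP lr); exists 1 => // x; rewrite mul1r.
  have [->|rx0] := eqVneq (r x) 0; first by rewrite normr0.
  rewrite -(@ler_pM2r _ `|r x|) ?normr_gt0// -expr2 -inner_normE.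
  apply: le_trans (cauchy_schwarz _ _).
  rewrite -{3}[x]rP innerDl (inner_adjoint _ _ bh) ah ger0_norm.
    by rewrite lerDl inner_ge0.
  by rewrite addr_ge0// inner_ge0.
exists r; split=> //.
- apply: mem_vna => //; split=> // b Nb x; apply: inj.
  rewrite rP -!(commutant_app Nb Nh) -(bopD (vna_bop (vna_commutant vN) Nb)).
  by rewrite rP.
- apply: adjoint_eq => x y.
  rewrite -{1}[y]rP -{2}[x]rP innerDr innerDl; congr (_ + _).
  by rewrite !inner_adjoint// ah.
- by move=> x; apply: inj; rewrite rP -(bopD bh) rP.
Qed.

(** For self-adjoint [h] with [r = (1 + h^2)^-1], the Cayley transform
    [u = (1 + i h) / (1 - i h)] equals [2 w - 1] with [w = r + i h r].  Both [r]
    and [h r] are linear combinations of [1], [u] and its adjoint, and an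
    operator that commutes with [r] and [h r] commutes with [h], since [r] is
    onto.  General elements follow by splitting them into self-adjoint parts. *)
Lemma vna_generated_by_unitaries N L :
  von_neumann_algebra N -> von_neumann_algebra L ->
  (forall u, N u -> unitary u -> L u) -> N `<=` L.
Proof.
move=> vN vL uL.
suff saL h : N h -> adjoint h = h -> L h.
  move=> a Na; have ba := vna_bop vN Na.
  have Na' := vna_adjoint vN Na; have ba' := vna_bop vN Na'.
  have L1 : L (a + adjoint a).
    apply: saL; first exact: vna_add.
    by rewrite adjoint_add// adjointK// addrC.
  have L2 : L ('i *: (a - adjoint a)).
    apply: saL; first by apply: vna_scale => //; exact: vna_diff.
    rewrite -scaleN1r adjoint_scale; last first.
      by apply: bounded_op_add => //; exact: bounded_op_scale.
    rewrite adjoint_add ?adjoint_scale ?adjointK//; last exact: bounded_op_scale.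
    rewrite conjCi rmorphN rmorph1 !scaleN1r scaleNr -scalerN opprD opprK.
    by rewrite addrC.
  have -> : a = 2^-1 *: ((a + adjoint a) + (- 'i) *: ('i *: (a - adjoint a))).
    rewrite scalerA mulNr -expr2 sqrCi opprK scale1r addrACA subrr addr0.
    by rewrite scalerDr -scalerDl (_ : _ + _ = 1) ?scale1r//; field.
  by apply: vna_scale => //; apply: vna_add => //; exact: vna_scale.
move=> Nh ah; have bh := vna_bop vN Nh.
have [r [Nr ar rP rh]] := resolvent_exists vN Nh ah.
have br := vna_bop vN Nr.
pose w := r + 'i *: (h \o r); pose w' := r - 'i *: (h \o r).
have Nhr : N (h \o r) by exact: vna_mul.
have bhr := vna_bop vN Nhr.
have wE x : w x = r x + 'i *: h (r x) by [].
have w'E x : w' x = r x - 'i *: h (r x) by [].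
have aw : adjoint w = w'.
  apply: adjoint_eq => x y; rewrite wE w'E !innerE conjCi mulNr opprK.
  rewrite rh (inner_adjoint x y br) (inner_adjoint (h x) y br).
  by rewrite (inner_adjoint _ _ bh) ar ah.
pose u := 2 *: w - idfun; pose u' := 2 *: w' - idfun.
have uE x : u x = 2 *: w x - x by [].
have u'E x : u' x = 2 *: w' x - x by [].
have Nw : N w by apply: vna_add => //; exact: vna_scale.
have Nu : N u.
  by apply: vna_diff => //; [exact: vna_scale|exact: vna_one].
have bw := vna_bop vN Nw; have bu := vna_bop vN Nu.
have bw' : bounded_op w' by rewrite -aw; exact: bounded_adjoint.
have au : adjoint u = u'.
  apply: adjoint_eq => x y; rewrite uE u'E.
  rewrite innerDl innerNl innerZl innerDr innerNr innerZr conjC_nat.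
  by rewrite (inner_adjoint _ _ bw) aw.
have comb x : r (r x) + h (h (r (r x))) = r x by rewrite rP.
(* [w] and its adjoint satisfy [w w^* = w^* w = r] and [w + w^* = 2 r], which
   amounts to the unitarity of [2 w - 1]. *)
have ww' x : w (w' x) = r x.
  rewrite wE w'E (bopB br) (bopB bh) (bopZ br) (bopZ bh) -!rh -[RHS]comb.
  by rewrite scalerBr scalerA -expr2 sqrCi scaleN1r opprK addrA subrK.
have w'w x : w' (w x) = r x.
  rewrite wE w'E (bopD br) (bopD bh) (bopZ br) (bopZ bh) -!rh -[RHS]comb.
  rewrite scalerDr scalerA -expr2 sqrCi scaleN1r opprD opprK addrA.
  by rewrite addrK.
have sw x : w x + w' x = 2 *: r x.
  by rewrite wE w'E addrACA subrr addr0 scaler_nat mulr2n.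
have uu : unitary u.
  rewrite /unitary au; split; apply/funext => x; rewrite /comp /=.
    rewrite u'E uE (bopB bw') (bopZ bw') w'w -sw addrK.
    by rewrite opprB addrC subrK.
  rewrite uE u'E (bopB bw) (bopZ bw) ww' -sw addrAC subrr add0r.
  by rewrite opprB addrC subrK.
have Lu := uL _ Nu uu.
have Lw : L w.
  have -> : w = 2^-1 *: (u + idfun).
    by rewrite /u subrK scalerA mulVf ?scale1r// pnatr_eq0.
  by apply: vna_scale => //; apply: vna_add => //; exact: vna_one.
have Lw' : L w' by rewrite -aw; exact: vna_adjoint.
have Lr : L r.
  have -> : r = 2^-1 *: (w + w').
    rewrite /w /w' addrACA subrr addr0.
    by rewrite scalerDr -scalerDl (_ : _ + _ = 1) ?scale1r//; field.
  by apply: vna_scale => //; exact: vna_add.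
have Lhr : L (h \o r).
  have -> : h \o r = - 'i *: (w - r).
    rewrite /w addrAC subrr add0r scalerA mulNr -expr2 sqrCi opprK.
    by rewrite scale1r.
  by apply: vna_scale => //; exact: vna_diff.
apply: mem_vna => //; split=> // b Lb x.
have bb := vna_bop (vna_commutant vL) Lb.
rewrite -[x]rP; set y := x + h (h x).
have -> : r x + h (h (r x)) = r y by rewrite rh (rh (h x)) -(bopD br).
have cr := commutant_app Lb Lr; have chr := commutant_app Lb Lhr.
by rewrite cr; apply/esym; exact: chr.
Qed.

End VonNeumann.

(** * Matrix units in type III algebras *)
Section MatrixUnits.
Variables (R : realType) (H : hilbertType R) (n : nat).
Implicit Types (x y z : H) (c : R[i]) (M : set (H -> H)).
Implicit Types (E F : 'I_n -> 'I_n -> H -> H).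

Record matrix_units M E : Prop := MatrixUnits {
  mu_mem : forall i j, M (E i j);
  mu_adj : forall i j, adjoint (E i j) = E j i;
  mu_mul : forall i j k x, E i j (E j k x) = E i k x;
  mu_orth : forall i j k l x, j != k -> E i j (E k l x) = 0 }.

(** [F] extends [E] when [F] agrees with [E] on the ranges of the [E k l]; in
    that case [F i j] is [E i j] plus an operator that vanishes on the support
    of [E]. *)
Definition mu_le E F := forall i j k l x, F i j (E k l x) = E i j (E k l x).

Variable M : set (H -> H).
Hypothesis vM : von_neumann_algebra M.

Lemma mu_bop E : matrix_units M E -> forall i j, bounded_op (E i j).
Proof. by move=> mE i j; exact: vna_bop vM (mu_mem mE i j). Qed.

Lemma mu_inner E : matrix_units M E -> forall i j x y,
  inner (E i j x) y = inner x (E j i y).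
Proof.
by move=> mE i j x y; rewrite inner_adjoint ?(mu_adj mE)//; exact: mu_bop.
Qed.

Lemma mu_norm E : matrix_units M E -> forall i j x, `|E i j x| <= `|x|.
Proof.
move=> mE i j x.
have e k : `|E k j x| ^+ 2 = inner (E j j x) x.
  by rewrite -inner_normE (mu_inner mE) (mu_mul mE) (mu_inner mE).
have jx : `|E j j x| <= `|x|.
  have [->|jx0] := eqVneq (E j j x) 0; first by rewrite normr0.
  rewrite -(@ler_pM2l _ `|E j j x|) ?normr_gt0// -expr2 e.
  rewrite -[X in X <= _]ger0_norm ?cauchy_schwarz//.
  by rewrite -(e j) exprn_ge0.
apply: le_trans jx; rewrite -(@ler_pXn2r _ 2)// ?nnegrE//.
by rewrite e -(e j).
Qed.

(** The square norm of the increment [(F - E) i j x] is an increment of the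
    numbers [inner (E j j x) x].  As these increase along a chain and are
    bounded by [inner x x], this makes [E i j x] Cauchy. *)
Lemma mu_dist E F i j x : matrix_units M E -> matrix_units M F -> mu_le E F ->
  `|E i j x - F i j x| ^+ 2 = inner (F j j x) x - inner (E j j x) x.
Proof.
move=> mE mF EF; rewrite -inner_normE !innerE.
have -> : inner (F i j x) (E i j x) = inner (E j j x) x.
  by rewrite (mu_inner mF) EF (mu_mul mE) (mu_inner mE).
have -> : inner (E i j x) (F i j x) = inner (E j j x) x.
  rewrite (innerC (E i j x)) (mu_inner mF) EF (mu_mul mE) -innerC.
  by [].
have -> : inner (E i j x) (E i j x) = inner (E j j x) x.
  by rewrite (mu_inner mE) (mu_mul mE) (mu_inner mE).
have -> : inner (F i j x) (F i j x) = inner (F j j x) x.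
  by rewrite (mu_inner mF) (mu_mul mF) (mu_inner mF).
by rewrite addrN add0r opprK addrC.
Qed.

Lemma mu_le_refl E : mu_le E E.
Proof. by []. Qed.

Lemma mu_le_trans E F G : matrix_units M E -> matrix_units M F ->
  mu_le E F -> mu_le F G -> mu_le E G.
Proof.
move=> mE mF EF FG i j k l x.
have e : E k l x = F k k (E k l x) by rewrite EF (mu_mul mE).
by rewrite e FG -e EF.
Qed.

Lemma mu_zero : matrix_units M (fun _ _ => 0).
Proof.
split=> //; first by move=> _ _; exact: vna_zero.
move=> _ _; apply: adjoint_eq => x y.
change (inner 0 y = inner x 0); by rewrite inner0l inner0r.
Qed.

Section ChainLimit.
Variable D : set ('I_n -> 'I_n -> H -> H).
Hypotheses (DM : forall E, D E -> matrix_units M E) (D0 : D !=set0).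
Hypothesis Dtot : forall E F, D E -> D F -> mu_le E F \/ mu_le F E.

(* Tails of the chain. *)
Let Fil : set_system ('I_n -> 'I_n -> H -> H) :=
  [set P | exists2 E, D E & forall F, D F -> mu_le E F -> P F].

Local Instance Fil_proper : ProperFilter Fil.
Proof.
apply: Build_ProperFilter_ex => [P [E DE EP]|].
  by exists E; exact: EP.
split.
- by have [E DE] := D0; exists E.
- move=> P Q [E DE EP] [E' DE' EQ].
  have [EE'|E'E] := Dtot DE DE'.
  + exists E' => // F DF E'F; split; last exact: EQ.
    by apply: EP => //; exact: (mu_le_trans (DM DE) (DM DE')).
  + exists E => // F DF EF; split; first exact: EP.
    by apply: EQ => //; exact: (mu_le_trans (DM DE') (DM DE)).
- by move=> P Q PQ [E DE EP]; exists E => // F DF /(EP _ DF)/PQ.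
Qed.

Lemma chain_cvg i j x : exists l : H, E i j x @[E --> Fil] --> l.
Proof.
apply: cauchy_limit => e e0; have [E0 DE0] := D0.
pose S : set R[i] := [set inner x x - inner (E j j x) x | E in D].
have [||d [dS Sd]] := @complex_inf R S 0.
- by exists (inner x x - inner (E0 j j x) x), E0.
- move=> _ [E DE <-]; have mE := DM DE; rewrite subr_ge0.
  have -> : inner (E j j x) x = `|E j j x| ^+ 2.
    by rewrite -inner_normE [RHS](mu_inner mE) (mu_mul mE) (mu_inner mE).
  by rewrite inner_normE ler_pXn2r ?nnegrE// mu_norm.
have [|_ [E DE <-] Ed] := Sd (e ^+ 2); first by rewrite exprn_gt0.
exists (E i j x); exists E => // F DF EF /=.
rewrite -(@ltr_pXn2r _ 2)// ?nnegrE//; last exact: ltW.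
rewrite (mu_dist _ _ _ (DM DE) (DM DF) EF).
have h : d <= inner x x - inner (F j j x) x by apply: dS; exists F.
rewrite -(ltrD2l d) (le_lt_trans _ Ed)//.
apply: le_trans (lerD h (lexx _)) _.
by rewrite addrA subrK.
Qed.

Lemma chain_lim_eq (V : normedModType R[i])
    (f g : ('I_n -> 'I_n -> H -> H) -> V) (l l' : V) E :
  D E -> (forall F, D F -> mu_le E F -> f F = g F) ->
  f F @[F --> Fil] --> l -> g F @[F --> Fil] --> l' -> l = l'.
Proof.
move=> DE fg fl gl; apply: (cvg_unique (@norm_hausdorff _ _) fl).
apply: (cvg_trans _ gl); apply: near_eq_cvg.
by exists E => // F DF EF; exact/esym/fg.
Qed.

(** Strong limits of the operators along the chain.  For products, pass to the
    limit in one factor at a time: [L i j (F k l x) = F i j (F k l x)] holds for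
    each [F] in the chain, and [L i j] is continuous. *)
Lemma chain_bound : exists2 L, matrix_units M L & forall E, D E -> mu_le E L.
Proof.
have [E0 DE0] := D0.
have /choice[L' L'P] : forall t : 'I_n * 'I_n * H, exists l : H,
    E t.1.1 t.1.2 t.2 @[E --> Fil] --> l by move=> t; exact: chain_cvg.
pose L i j x := L' (i, j, x).
have LP i j x : E i j x @[E --> Fil] --> L i j x by exact: (L'P (i, j, x)).
have Ladj i j x y : inner (L i j x) y = inner x (L j i y).
  apply: (chain_lim_eq DE0 (f := fun E => inner (E i j x) y)
    (g := fun E => inner x (E j i y))).
  - by move=> F DF _; rewrite (mu_inner (DM DF)).
  - exact: cvg_innerl.
  - exact: cvg_innerr.
have Llin i j : linear (L i j).
  move=> c x y; apply: inner_injl => z.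
  by rewrite !innerE !Ladj !innerE.
have Lnorm i j x : `|L i j x| <= `|x|.
  rewrite real_leNgt ?normr_real//; apply/negP => lt.
  have e0 : 0 < `|L i j x| - `|x| by rewrite subr_gt0.
  have /cvgrPdist_lt /(_ _ e0) [E DE /(_ E DE (mu_le_refl E)) /= h] := LP i j x.
  have : `|L i j x| < `|L i j x| - `|x| + `|x|.
    apply: (@le_lt_trans _ _ (`|L i j x - E i j x| + `|E i j x|)).
      by rewrite (le_trans _ (ler_normD _ _))// subrK.
    by apply: ltr_leD => //; exact: (mu_norm (DM DE)).
  by rewrite subrK ltxx.
have Lbop i j : bounded_op (L i j).
  by apply/(bounded_opP (Llin i j)); exists 1 => // x; rewrite mul1r.
have Lle E : D E -> mu_le E L.
  move=> DE i j k l x.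
  apply: (chain_lim_eq DE (f := fun F => F i j (E k l x))
    (g := fun F => E i j (E k l x))) => //.
  exact: cvg_cst.
exists L => //; split.
- move=> i j; apply: mem_vna => //; split=> // b Mb x.
  have bb := vna_bop (vna_commutant vM) Mb.
  apply: (chain_lim_eq DE0 (f := fun F => F i j (b x))
    (g := fun F => b (F i j x))) => //; last exact: cvg_bop.
  by move=> F DF _; rewrite (commutant_app Mb (mu_mem (DM DF) i j)).
- by move=> i j; apply: adjoint_eq => x y; exact: Ladj.
- move=> i j k x.
  apply: (chain_lim_eq DE0 (f := fun F => L i j (F j k x))
    (g := fun F => F i k x)) => //; last exact: cvg_bop.
  by move=> F DF _; rewrite (Lle F DF) (mu_mul (DM DF)).
- move=> i j k l x jk.
  apply: (chain_lim_eq DE0 (f := fun F => L i j (F k l x))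
    (g := fun F => 0)) => //; [|exact: cvg_bop|exact: cvg_cst].
  by move=> F DF _; rewrite (Lle F DF) (mu_orth (DM DF)).
Qed.
End ChainLimit.

(** With [p = r - q], the range of [p] is orthogonal to that of [v].  Hence the
    operators [v^i p v^*^j] are matrix units; they live below [r], so they are
    orthogonal to [E] and can be added to it.  The final clause detects that
    something was gained: if no new diagonal unit is added then [p = 0]. *)
Lemma mu_extend E r v q : matrix_units M E ->
  (forall x, r x = x - \sum_k E k k x) -> M r -> M v ->
  adjoint r = r -> r \o r = r -> adjoint q = q -> r \o q = q ->
  adjoint v \o v = r -> v \o adjoint v = q ->
  exists2 F, matrix_units M F & mu_le E F /\
    forall i, (forall x, E i i (F i i x) = F i i x) -> q = r.
Proof.
move=> mE rE Mr Mv ar rr aq rq vv_r vv_q.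
pose va := adjoint v.
have Mva : M va by exact: vna_adjoint.
have br := vna_bop vM Mr; have bv := vna_bop vM Mv; have bva := vna_bop vM Mva.
have vavE x : va (v x) = r x by rewrite -vv_r.
have vvaE x : v (va x) = q x by rewrite -vv_q.
have rrE x : r (r x) = r x by rewrite -[in RHS]rr.
have rqE x : r (q x) = q x by rewrite -[in RHS]rq.
have Mq : M q by rewrite -vv_q; exact: vna_mul.
have bq := vna_bop vM Mq.
have r_inner x y : inner (r x) y = inner x (r y) by rewrite inner_adjoint// ar.
have q_inner x y : inner (q x) y = inner x (q y) by rewrite inner_adjoint// aq.
have v_inner x y : inner (v x) y = inner x (va y) by exact: inner_adjoint.
have va_inner x y : inner (va x) y = inner x (v y) by exact/esym/inner_adjointr.
(* [v] is a partial isometry from [r] to [q <= r]. *)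
have vr x : v (r x) = v x.
  apply/esym/eqP; rewrite -subr_eq0 -(bopB bv); apply/eqP/inner_eq0.
  by rewrite v_inner vavE (bopB br) rrE subrr inner0r.
have qv x : q (v x) = v x by rewrite -vvaE vavE vr.
have rv x : r (v x) = v x by rewrite -qv rqE.
have rva x : r (va x) = va x.
  by apply: inner_injl => y; rewrite r_inner !va_inner vr.
have var x : va (r x) = va x.
  by apply: inner_injl => y; rewrite !va_inner r_inner rv.
have qr x : q (r x) = q x.
  by apply: inner_injl => y; rewrite !q_inner r_inner rqE.
have qq x : q (q x) = q x by rewrite -!vvaE vavE rva.
pose p x := r x - q x.
have Mp : M p by exact: vna_diff.
have bp := vna_bop vM Mp.
have p_inner x y : inner (p x) y = inner x (p y).
  by rewrite /p !innerE r_inner q_inner.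
have rp x : r (p x) = p x by rewrite /p (bopB br) rrE rqE.
have pr x : p (r x) = p x by rewrite /p rrE qr.
have pp x : p (p x) = p x.
  by rewrite {2}/p (bopB bp) pr /p rqE qq subrr subr0.
have pv x : p (v x) = 0.
  by rewrite /p rv qv subrr.
have vap x : va (p x) = 0.
  by apply: inner_injl => y; rewrite va_inner p_inner pv inner0l inner0r.
have iter_r k x : r x = x -> r (iter k v x) = iter k v x.
  by case: k => //= k _; exact: rv.
have iterK k x : r x = x -> iter k va (iter k v x) = x.
  move=> rx; elim: k => // k IH.
  by rewrite iterSr [iter k.+1 v x]iterS vavE iter_r.
have iter_inner k x y : inner (iter k v x) y = inner x (iter k va y).
  by elim: k x y => //= k IH x y; rewrite v_inner IH -iterSr.
have iterr_inner k x y : inner (iter k va x) y = inner x (iter k v y).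
  by rewrite innerC -iter_inner -innerC.
have iter_va0 k : iter k va 0 = 0 by elim: k => //= k ->; exact: bop0.
have iter_v0 k : iter k v 0 = 0 by elim: k => //= k ->; exact: bop0.
have Miter k a : M a -> M (iter k a).
  move=> Ma; elim: k => [|k IH]; first exact: vna_one.
  exact: (vna_mul vM Ma IH).
pose G (i j : 'I_n) x := iter i v (p (iter j va x)).
have MG i j : M (G i j).
  exact: (vna_mul vM (Miter _ _ Mv) (vna_mul vM Mp (Miter _ _ Mva))).
have bG i j := vna_bop vM (MG i j).
have G_inner i j x y : inner (G i j x) y = inner x (G j i y).
  by rewrite /G iter_inner p_inner iterr_inner.
have Gmul i j k x : G i j (G j k x) = G i k x.
  by rewrite /G iterK// pp.
have Gorth i j k l x : j != k -> G i j (G k l x) = 0.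
  rewrite neq_ltn /G => /orP[jk|kj].
    rewrite -(subnKC jk) addSnnS iterD iterK; last by rewrite /= rv.
    by rewrite /= pv iter_v0.
  rewrite -(subnK kj) addnS -addSn iterD iterK// iterSr vap iter_va0.
  by rewrite (bop0 bp) iter_v0.
have rG i j x : r (G i j x) = G i j x by rewrite iter_r.
have Gr i j x : G i j (r x) = G i j x.
  by rewrite /G; case: (nat_of_ord j) => [|k]; rewrite ?pr// !iterSr var.
have rE0 i j x : r (E i j x) = 0.
  rewrite rE (bigD1 i)//= (mu_mul mE) big1 ?addr0 ?subrr// => k ki.
  exact: (mu_orth mE).
have Er0 i j x : E i j (r x) = 0.
  by apply: inner_injl => y; rewrite (mu_inner mE) r_inner rE0 inner0l inner0r.
have EG i j k l x : E i j (G k l x) = 0 by rewrite -rG Er0.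
have GE i j k l x : G i j (E k l x) = 0 by rewrite -Gr rE0 (bop0 (bG _ _)).
have bE := mu_bop mE.
pose F i j x := E i j x + G i j x.
exists F; first split.
- by move=> i j; apply: (vna_add vM); [exact: (mu_mem mE)|exact: MG].
- move=> i j; apply: adjoint_eq => x y.
  by rewrite /F innerDl innerDr (mu_inner mE) G_inner.
- move=> i j k x; rewrite /F (bopD (bE i j)) (bopD (bG i j)).
  by rewrite EG GE (mu_mul mE) Gmul addr0 add0r.
- move=> i j k l x jk; rewrite /F (bopD (bE i j)) (bopD (bG i j)).
  by rewrite EG GE (mu_orth mE)// Gorth// !addr0.
split.
- by move=> i j k l x; rewrite /F GE addr0.
- move=> i h; apply/funext => x.
  have := h (iter i v (p x)).
  rewrite /F (bopD (bE i i)) EG addr0 (mu_mul mE) => /eqP.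
  rewrite eq_sym addrC -subr_eq0 addrK => /eqP G0.
  have : iter i va (G i i (iter i v (p x))) = 0 by rewrite G0 iter_va0.
  rewrite /G iterK ?rp// iterK ?rp// pp => /eqP.
  by rewrite /p subr_eq0 => /eqP.
Qed.

(** The remainder of a maximal system is finite: an equivalence of [r] with a
    subprojection [q] extends the system, so maximality forces [q = r].  In type
    III this means [r = 0]. *)
Lemma typeIII_matrix_units (i0 : 'I_n) : typeIII M ->
  exists2 E, matrix_units M E & forall x, \sum_i E i i x = x.
Proof.
move=> III.
pose T := {E | matrix_units M E}.
pose t0 : T := exist _ _ mu_zero.
pose le : rel T := fun s t => `[< mu_le (sval s) (sval t) >].
have [||D Dtot|[E mE] maxE] := @ZL_preorder T t0 le.
- by move=> t; apply/asboolP; exact: mu_le_refl.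
- move=> [r mr] [s ms] [t mt] /asboolP rs /asboolP st; apply/asboolP.
  exact: (mu_le_trans mr ms).
- have [D0|/set0P[s0 Ds0]] := eqVneq D set0.
    by exists t0 => s; rewrite D0.
  have [|||L mL DL] := @chain_bound [set sval s | s in D].
  + by move=> _ [[E mE] _ <-].
  + by exists (sval s0), s0.
  + move=> _ _ [s Ds <-] [t Dt <-].
    by have [/asboolP|/asboolP] := Dtot s t Ds Dt; [left|right].
  + by exists (exist _ L mL) => s Ds; apply/asboolP/DL; exists s.
have {}maxE F : matrix_units M F -> mu_le E F -> mu_le F E.
  by move=> mF EF; have := maxE (exist _ F mF) (asboolT EF) => /asboolP.
exists E => //.
pose r x := x - \sum_k E k k x.
have bE := mu_bop mE.
have Mr : M r.
  have -> : r = idfun - \sum_k E k k.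
    by apply/funext => x; rewrite /r -(sum_opE (fun k => E k k)).
  apply: vna_diff => //; first exact: vna_one.
  by apply: vna_sum => // k; exact: (mu_mem mE).
have br := vna_bop vM Mr.
have Er i j x : E i j (r x) = 0.
  rewrite /r (bopB (bE i j)) (bop_sum (bE i j)) (bigD1 j)//= (mu_mul mE).
  by rewrite big1 ?addr0 ?subrr// => k kj; rewrite (mu_orth mE)// eq_sym.
have ar : adjoint r = r.
  apply: adjoint_eq => x y; rewrite /r !innerE; congr (_ - _).
  rewrite linear_sumlz linear_sumr; apply: eq_bigr => k _.
  exact: (mu_inner mE).
have rr : r \o r = r.
  apply/funext => x /=; rewrite {1}/r big1 ?subr0// => k _; exact: Er.
suff r0 : r = 0.
  move=> x; apply/esym/eqP; rewrite -subr_eq0; apply/eqP.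
  by rewrite -/(r x) r0.
apply: III; first by [].
move=> q [Mq qq aq] rq [v [Mv vv_r vv_q]].
have [F mF [EF Fr]] := mu_extend mE (fun=> erefl) Mr Mv ar rr aq rq vv_r vv_q.
apply: (Fr i0) => x.
have FE := maxE F mF EF.
by rewrite FE (mu_mul mF).
Qed.

End MatrixUnits.

(** * Decomposition of an algebra along matrix units *)
Section Amplification.
Variables (R : realType) (H : hilbertType R) (n : nat).
Variables (M : set (H -> H)) (E : 'I_n -> 'I_n -> H -> H).
Hypotheses (vM : von_neumann_algebra M) (mE : matrix_units M E).
Implicit Types (a b : H -> H) (x y z : H) (i j k l p q : 'I_n).

Let bE := mu_bop vM mE.

(** The matrix coefficient of [b] at [(k, l)], copied to all diagonal positions
    so that it commutes with the matrix units. *)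
Definition amplify k l b x := \sum_m E m k (b (E l m x)).

Lemma amplify_mem k l b : M b -> M (amplify k l b).
Proof.
move=> Mb; have -> : amplify k l b = \sum_m (E m k \o b \o E l m).
  by apply/funext => x; rewrite sum_opE.
apply: vna_sum => // m; apply: (vna_mul vM); last exact: (mu_mem mE).
by apply: (vna_mul vM) => //; exact: (mu_mem mE).
Qed.

Lemma amplifyE k l b p q x : bounded_op b ->
  amplify k l b (E p q x) = E p k (b (E l q x)).
Proof.
move=> bb; rewrite /amplify (bigD1 p)//= (mu_mul mE) big1 ?addr0// => m mp.
by rewrite (mu_orth mE)// (bop0 bb) (bop0 (bE _ _)).
Qed.

Lemma unit_amplify k l b p q x :
  E p q (amplify k l b x) = E p k (b (E l q x)).
Proof.
rewrite /amplify (bop_sum (bE p q)) (bigD1 q)//= (mu_mul mE) big1 ?addr0// => m mq.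
by rewrite (mu_orth mE)// eq_sym.
Qed.

Definition units_commutant :=
  M `&` commutant [set a | exists i j, a = E i j].

Lemma units_commutant_vna : von_neumann_algebra units_commutant.
Proof.
apply: rel_commutant_vna => // [_ [i [j ->]]|_ [i [j ->]]]; first exact: bE.
by exists j, i; rewrite (mu_adj mE).
Qed.

Lemma amplify_commutant k l b : M b -> units_commutant (amplify k l b).
Proof.
move=> Mb; split; first exact: amplify_mem.
apply/commutantP; split; first exact: vna_bop vM (amplify_mem _ _ Mb).
move=> _ [p [q ->]] x; rewrite amplifyE ?unit_amplify//.
exact: vna_bop vM Mb.
Qed.

Hypothesis sumE : forall x, \sum_i E i i x = x.

Lemma unit_decomposition a x : bounded_op a ->
  a x = \sum_i \sum_j E i j (amplify i j a x).
Proof.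
move=> ba; rewrite -[LHS]sumE; apply: eq_bigr => i _.
rewrite -{1}[x]sumE (bop_sum ba) (bop_sum (bE i i)).
by apply: eq_bigr => j _; rewrite unit_amplify.
Qed.

Lemma units_generate L : von_neumann_algebra L -> (forall i j, L (E i j)) ->
  units_commutant `<=` L -> M `<=` L.
Proof.
move=> vL LE LA a Ma; have ba := vna_bop vM Ma.
have -> : a = \sum_i \sum_j (E i j \o amplify i j a).
  apply/funext => x; rewrite sum_opE (unit_decomposition _ ba).
  by apply: eq_bigr => i _; rewrite sum_opE.
apply: vna_sum => // i; apply: vna_sum => // j.
by apply: (vna_mul vL) => //; exact/LA/amplify_commutant.
Qed.

Hypothesis fM : is_factor M.

Lemma units_commutant_app a : units_commutant a ->
  forall i j x, a (E i j x) = E i j (a x).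
Proof.
by move=> [_ Ta] i j x; apply: (commutant_app Ta); exists i, j.
Qed.

(** The amplification of [b] commutes with the matrix units, and with their
    relative commutant because [b] does; these generate [M], so it is central,
    that is scalar. *)
Lemma corner_scalar k l b : M b ->
  (forall a, units_commutant a -> forall x, b (a x) = a (b x)) ->
  exists c, forall i j x, E i k (b (E l j x)) = c *: E i j x.
Proof.
move=> Mb bA; have bb := vna_bop vM Mb.
pose t := amplify k l b.
have Mt : M t := amplify_mem k l Mb.
have bt := vna_bop vM Mt.
have tA a x : units_commutant a -> t (a x) = a (t x).
  move=> Aa; have ba := vna_bop units_commutant_vna Aa.
  rewrite /t /amplify (bop_sum ba); apply: eq_bigr => m _.
  by rewrite -!(units_commutant_app Aa) bA// (units_commutant_app Aa).
have tE i j y : t (E i j y) = E i j (t y).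
  by rewrite /t amplifyE// unit_amplify.
have : (M `&` commutant M) t.
  split=> //; apply/commutantP; split=> // a Ma x.
  have ba := vna_bop vM Ma.
  rewrite !(unit_decomposition _ ba) (bop_sum bt); apply: eq_bigr => i _.
  rewrite (bop_sum bt); apply: eq_bigr => j _.
  by rewrite -(tA (amplify i j a)) ?tE//; exact: amplify_commutant.
rewrite fM.2 => -[c _ tc]; exists c => i j x.
by rewrite -amplifyE// -/t -tc.
Qed.

End Amplification.

(** * The block algebra *)
Section Block.
Variables (R : realType) (H : hilbertType R).
Variables (M : set (H -> H)) (E : 'I_3 -> 'I_3 -> H -> H).
Hypotheses (vM : von_neumann_algebra M) (fM : is_factor M).
Hypotheses (mE : matrix_units M E) (sumE : forall x, \sum_i E i i x = x).
Implicit Types (a b : H -> H) (x y z : H).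

Let bE := mu_bop vM mE.
Let last : 'I_3 := ord_max.
Let i0 : 'I_3 := ord0.
Let i1 : 'I_3 := lift ord0 ord0.

Definition block_units :=
  [set a | exists i j : 'I_3, (i == ord_max) = (j == ord_max) /\ a = E i j].

(** This is the span of the block units, written as their relative bicommutant:
    the structure of a von Neumann algebra is then automatic, and its being a
    block algebra is expressed by [block_corner]. *)
Definition block_algebra := M `&` commutant (M `&` commutant block_units).

Let P := M `&` commutant block_units.

Let vP : von_neumann_algebra P.
Proof.
apply: rel_commutant_vna => // [_ [i [j [_ ->]]]|_ [i [j [ij ->]]]].
  exact: bE.
by exists j, i; rewrite (mu_adj mE).
Qed.

Lemma block_algebra_vna : von_neumann_algebra block_algebra.
Proof.
apply: rel_commutant_vna => // a; first exact: vna_bop vP.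
exact: vna_adjoint vP a.
Qed.

Lemma block_units_sub : block_units `<=` block_algebra.
Proof.
move=> _ [i [j [ij ->]]]; split; first exact: (mu_mem mE).
apply/commutantP; split=> [|a [_ Sa] x]; first exact: bE.
by rewrite (commutant_app Sa)//; exists i, j.
Qed.

Let A := units_commutant M E.

Let AP : A `<=` P.
Proof.
move=> a [Ma Ta]; split=> //; apply: commutant_anti Ta => _ [i [j [_ ->]]].
by exists i, j.
Qed.

Let vA : von_neumann_algebra A := units_commutant_vna vM mE.

Let block_comm b p x : block_algebra b -> P p -> b (p x) = p (b x).
Proof. by move=> [_ Pb] Pp; exact: (commutant_app Pb). Qed.

Let block_bop b : block_algebra b -> bounded_op b.
Proof. exact: vna_bop block_algebra_vna. Qed.

Lemma block_corner k l b : block_algebra b ->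
  exists c, forall i j x, E i k (b (E l j x)) = c *: E i j x.
Proof.
move=> Bb; apply: (corner_scalar vM mE sumE fM) => [|a Aa x]; first exact: Bb.1.
exact: (block_comm x Bb (AP Aa)).
Qed.

(** The images [E i j b E j i] and [E j i b E i j] are multiples of diagonal
    units, which lie in the block algebra even if [E i j] does not. *)
Lemma unit_normalises i j : normaliser M block_algebra (E i j).
Proof.
have Bii c k : block_algebra (c *: E k k).
  apply: (vna_scale block_algebra_vna); apply: block_units_sub.
  by exists k, k.
split=> [|b Bb]; first exact: (mu_mem mE).
rewrite (mu_adj mE); split.
  have [c cE] := block_corner j j Bb.
  have -> : E i j \o b \o E j i = c *: E i i by apply/funext => x; exact: cE.
  exact: Bii.
have [c cE] := block_corner i i Bb.
have -> : E j i \o b \o E i j = c *: E j j by apply/funext => x; exact: cE.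
exact: Bii.
Qed.

Lemma block_algebra_regular : regular_in M block_algebra.
Proof.
apply/seteqP; split.
  by apply: bigcap_inf => //=; split; [split|move=> a []].
apply: sub_bigcap => L [[vL LM] NL].
apply: (units_generate vM mE sumE vL) => [i j|].
  by apply: NL; exact: unit_normalises.
apply: (vna_generated_by_unitaries vA vL) => u Au [u1 u2].
apply: NL; split; first exact: Au.1.
have conj b w w' : block_algebra b -> A w -> w \o w' = idfun ->
    block_algebra (w \o b \o w').
  move=> Bb Aw ww'; suff -> : w \o b \o w' = b by [].
  apply/funext => x; rewrite /comp /= -block_comm//; last exact: AP.
  by rewrite -[w (w' x)]/((w \o w') x) ww'.
move=> b Bb; split; first exact: conj.
by apply: conj => //; exact: (vna_adjoint vA).
Qed.

Lemma unit_neq0 i : E i i <> 0.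
Proof.
move=> Ei0; apply: fM.1; apply/funext => x; rewrite -[LHS]/x -[LHS]sumE.
rewrite big1// => k _.
rewrite -(mu_mul mE k i k) -[E i k x](mu_mul mE i i k) Ei0.
exact: (bop0 (bE k i)).
Qed.

Let q := E last last.

Let Pq : P q.
Proof.
split; first exact: (mu_mem mE).
apply/commutantP; split=> [|_ [i [j [ij ->]]] x]; first exact: bE.
rewrite /q /last; have [e|e] := eqVneq i ord_max.
  move: ij; rewrite e eqxx => /esym/eqP ->.
  by [].
move: ij; rewrite (negbTE e) => /esym/negbT e'.
by rewrite !(mu_orth mE)// eq_sym.
Qed.

Let Bq : block_algebra q.
Proof. by apply: block_units_sub; exists last, last. Qed.

(** The conjugate [w = u q u^*] is a central projection of the block algebra and
    is minimal, as [q] is.  By minimality [w (E i j) w = c w]; for an off-diagonal unit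
    of the 2 x 2 block it is nilpotent, so [c = 0].  Hence [w] is orthogonal to
    that block, which leaves [w = q]. *)
Lemma unitary_normaliser_fixes u : unitary_normaliser M block_algebra u ->
  forall x, u (q x) = q (u x).
Proof.
move=> [Mu [u1 u2] uB].
have bu := vna_bop vM Mu.
pose u' := adjoint u.
have uu' x : u (u' x) = x by rewrite -[LHS]/((u \o u') x) u2.
have u'u x : u' (u x) = x by rewrite -[LHS]/((u' \o u) x) u1.
pose w := u \o q \o u'.
have wE x : w x = u (q (u' x)) by [].
have Bw : block_algebra w by rewrite -uB; exists q.
have bw := block_bop Bw; have bq := block_bop Bq.
have qq x : q (q x) = q x by exact: (mu_mul mE).
have ww x : w (w x) = w x by rewrite !wE u'u qq.
have wC b x : block_algebra b -> b (w x) = w (b x).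
  rewrite -{1}uB => -[b' Bb' <-] /=; rewrite !wE -/u' !u'u.
  by rewrite (block_comm _ Bb' Pq).
have wbw b : block_algebra b -> exists c, forall x, w (b (w x)) = c *: w x.
  rewrite -{1}uB => -[b' Bb' <-].
  have [c cE] := block_corner last last Bb'; exists c => x.
  by rewrite /= !wE -/u' !u'u /q cE (bopZ bu).
have w0 : w <> 0.
  move=> w0; apply: (@unit_neq0 last); apply/funext => x.
  have : u' (w (u x)) = q x by rewrite wE u'u u'u.
  move=> e; rewrite -[LHS]/(q x) -e w0.
  exact: (bop0 (bounded_adjoint bu)).
have offdiag i j : i != j -> i != last -> j != last ->
    forall x, w (E i j x) = 0.
  move=> ij il jl.
  have Bij : block_algebra (E i j).
    by apply: block_units_sub; exists i, j; rewrite (negbTE il) (negbTE jl).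
  have [c cE] := wbw _ Bij.
  suff c0 : c = 0.
    by move=> x; rewrite -ww -(wC _ _ Bij) cE c0 scale0r.
  have [//|c0] := eqVneq c 0; exfalso; apply: w0; apply/funext => x.
  have : c *: (c *: w x) = 0.
    rewrite -(cE x) -(cE (E i j (w x))) (wC _ (E i j (w x)) Bij).
    by rewrite (mu_orth mE) 1?eq_sym// !(bop0 bw).
  by move=> /eqP; rewrite !scaler_eq0 (negbTE c0) /= => /eqP.
have wq x : w (q x) = w x.
  rewrite -{2}[x]sumE (bop_sum bw) (bigD1 last)//= big1 ?addr0// => i il.
  have [j ij jl] : exists2 j, i != j & j != last.
    by exists (if i == i0 then i1 else i0); case: ifPn => [/eqP e|//]; rewrite ?e.
  by rewrite -(mu_mul mE i j i) offdiag.
have [c cE] := block_corner last last Bw.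
have wcq x : w x = c *: q x.
  by rewrite -wq -{1}[q x]qq (block_comm _ Bw Pq); exact: cE.
(* [w] is a nonzero idempotent multiple of [q]. *)
have c1 : c = 1.
  have [//|c1] := eqVneq c 1; exfalso; apply: w0; apply/funext => x.
  have : c *: ((c - 1) *: q x) = 0.
    have := ww x; rewrite !wcq (bopZ bq) qq => h.
    by rewrite scalerBl scale1r scalerBr h subrr.
  move=> /eqP; rewrite !scaler_eq0 subr_eq0 (negbTE c1) /= wcq.
  by move=> /orP[] /eqP ->; rewrite ?scale0r ?scaler0.
by move=> x; have := wcq (u x); rewrite wE u'u c1 scale1r.
Qed.

Lemma block_algebra_not_unitarily_regular :
  ~ unitarily_regular_in M block_algebra.
Proof.
move=> ur.
have Mq : M q := mu_mem mE last last.
have bq := vna_bop vM Mq.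
pose N := M `&` commutant [set q].
have sN : vn_subalgebra M N.
  split; last by move=> a [].
  apply: rel_commutant_vna => // _ ->; first by [].
  exact: (mu_adj mE).
have MN : M `<=` N.
  rewrite -{1}ur; apply: bigcap_inf => //=; split=> // u Uu.
  have Mu : M u by case: Uu.
  split=> //; apply/commutantP; split; first exact: vna_bop vM Mu.
  by move=> _ -> x; exact: unitary_normaliser_fixes.
have : (M `&` commutant M) q.
  split=> //; apply/commutantP; split=> // a Ma x.
  by rewrite (commutant_app (MN _ Ma).2 (erefl q)).
rewrite fM.2 => -[c _ cE].
have qE x : q x = c *: x by rewrite -cE.
have c0 : c = 0.
  apply/eqP/negP => /negP c0; apply: (@unit_neq0 i0); apply/funext => x.
  apply/eqP; rewrite -(inj_eq (scalerI c0)) -qE scaler0.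
  by rewrite /q (mu_orth mE).
by apply: (@unit_neq0 last); apply/funext => x; rewrite -/q qE c0 scale0r.
Qed.

End Block.

Theorem proposition3p10 (R : realType) (H : hilbertType R) (M : set (H -> H)) :
  von_neumann_algebra M -> is_factor M -> typeIII M ->
  exists B : set (H -> H),
    [/\ vn_subalgebra M B, regular_in M B & ~ unitarily_regular_in M B].
Proof.
move=> vM fM III.
have [E mE sumE] := typeIII_matrix_units vM (ord0 : 'I_3) III.
exists (block_algebra M E); split.
- by split; [exact: block_algebra_vna|move=> a []].
- exact: block_algebra_regular.
- exact: block_algebra_not_unitarily_regular.
Qed.
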